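(* Let $\Gamma$ be a finite, simple, connected graph of diameter $2$. Then $\Gamma$ is highly distance-balanced if and only if it is regular. Moreover, $\Gamma$ is $2$-distance-balanced but not $1$-distance-balanced if and only if $\Gamma$ is a nonregular join $\Gamma_1 + \cdots + \Gamma_t$ of $t \ge 2$ regular graphs $\Gamma_i$.
   Context: The join $\Gamma_1 + \Gamma_2$ of graphs with disjoint vertex sets is their disjoint union together with all edges joining a vertex of $\Gamma_1$ to a vertex of $\Gamma_2$ (associative and commutative). For vertices $u,v$, $W_{uv} = \{w \mid d(u,w) < d(v,w)\}$. For a positive integer $\ell$, a connected graph of diameter at least $\ell$ is $\ell$-distance-balanced if $|W_{uv}| = |W_{vu}|$ for all $u,v$ with $d(u,v)=\ell$. A connected graph of diameter $D$ is highly distance-balanced if it is $\ell$-distance-balanced for every $1 \le \ell \le D$. *)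

(* Defs.v *)
From mathcomp Require Import all_boot.

Set Implicit Arguments.
Unset Strict Implicit.
Unset Printing Implicit Defensive.

Record sgraph := SGraph {
  svertex :> finType;
  adj : rel svertex;
  adj_sym : symmetric adj;
  adj_irrefl : irreflexive adj
}.

Definition graph_connected (G : sgraph) : Prop :=
  0 < #|G| /\ forall u v : G, connect (@adj G) u v.

Definition walk_of_length (G : sgraph) (k : nat) (u v : G) : bool :=
  [exists p : k.-tuple G, path (@adj G) u p && (last u p == v)].

(* Least length of a walk from u to v: two vertices in the same component are
   always joined by a walk of length < #|G|, so searching k < #|G| suffices.
   Vertices in different components get the junk value #|G|; distances are
   only used in connected graphs. *)
Definition dist (G : sgraph) (u v : G) : nat :=
  find (fun k => walk_of_length k u v) (iota 0 #|G|).

Definition diameter (G : sgraph) : nat :=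
  \max_(u : G) \max_(v : G) dist u v.

Definition closer (G : sgraph) (u v : G) : {set G} :=
  [set w : G | dist u w < dist v w].

Definition distance_balanced (l : nat) (G : sgraph) : Prop :=
  [/\ 0 < l, graph_connected G, l <= diameter G &
      forall u v : G, dist u v = l -> #|closer u v| = #|closer v u|].

Definition highly_distance_balanced (G : sgraph) : Prop :=
  graph_connected G /\
  forall l : nat, 1 <= l <= diameter G -> distance_balanced l G.

Definition degree (G : sgraph) (v : G) : nat := #|[set w : G | adj v w]|.

Definition regular (G : sgraph) : Prop :=
  exists k : nat, forall v : G, degree v = k.

Definition join_adj (G H : sgraph) : rel (G + H)%type :=
  fun x y =>
    match x, y with
    | inl u, inl v => adj u v
    | inr u, inr v => adj u v
    | _, _ => true
    end.

Lemma join_adj_sym (G H : sgraph) : symmetric (@join_adj G H).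
Proof. by move=> [u|u] [v|v] //=; rewrite adj_sym. Qed.

Lemma join_adj_irrefl (G H : sgraph) : irreflexive (@join_adj G H).
Proof. by move=> [u|u] /=; rewrite adj_irrefl. Qed.

Definition join (G H : sgraph) : sgraph :=
  SGraph (@join_adj_sym G H) (@join_adj_irrefl G H).

(* iter_join F n is the (n + 1)-fold join F 0 + F 1 + ... + F n; the values of
   F above n are irrelevant. *)
Fixpoint iter_join (F : nat -> sgraph) (n : nat) : sgraph :=
  if n is n'.+1 then join (iter_join F n') (F n) else F 0.

Definition graph_iso (G H : sgraph) : Prop :=
  exists f : G -> H, bijective f /\ forall u v : G, adj (f u) (f v) = adj u v.

(* A graph is required to have at least one vertex to count as a summand; the
   join is taken up to isomorphism. *)
Definition join_of_regular_graphs (G : sgraph) : Prop :=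
  exists (t : nat) (F : nat -> sgraph),
    [/\ 2 <= t,
        forall i : nat, i < t -> 0 < #|F i| /\ regular (F i) &
        graph_iso G (iter_join F t.-1)].

(* Main.v *)
Require Import Defs.
From mathcomp Require Import all_boot.

(** In a graph of diameter 2, [closer u v] is [u] together with the neighbours
of [u] outside the closed neighbourhood of [v]; hence for [u <> v] the sets
[closer u v] and [closer v u] have equal size iff [u] and [v] have equal
degree.  So being 1-distance-balanced means that adjacent vertices have equal
degree, i.e. regularity (by connectedness), and being 2-distance-balanced means
that nonadjacent vertices have equal degree.  In the latter case vertices of
different degrees are adjacent, so the graph is the join of the subgraphs
induced on its degree classes, and each of these is regular. *)

Set Implicit Arguments.
Unset Strict Implicit.
Unset Printing Implicit Defensive.

Definition nonadj_eq_degree (G : sgraph) : Prop :=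
  forall u v : G, ~~ adj u v -> degree u = degree v.

(** * Distances and balance in diameter 2 *)

Lemma walk_of_length0 (G : sgraph) (u v : G) : walk_of_length 0 u v = (u == v).
Proof.
apply/existsP/idP => [[p]|uv]; first by rewrite (tuple0 p).
by exists [tuple]; rewrite /= uv.
Qed.

Lemma walk_of_length1 (G : sgraph) (u v : G) : walk_of_length 1 u v = adj u v.
Proof.
apply/existsP/idP => [[p]|uv].
  by case/tupleP: p => x p; rewrite (tuple0 p) /= andbT => /andP[ux /eqP <-].
by exists [tuple v]; rewrite /= uv eqxx.
Qed.

Lemma dist_le_card (G : sgraph) (u v : G) : dist u v <= #|G|.
Proof.
by rewrite /dist (leq_trans (find_size _ _)) // size_iota.
Qed.

Lemma dist_le_diameter (G : sgraph) (u v : G) : dist u v <= diameter G.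
Proof.
apply: leq_trans (leq_bigmax u).
exact: (leq_bigmax (F := fun w => dist u w) v).
Qed.

Lemma diameter_le_card (G : sgraph) : diameter G <= #|G|.
Proof. by do 2!apply/bigmax_leqP => ? _; apply: dist_le_card. Qed.

Lemma distE (G : sgraph) (u v : G) : diameter G = 2 ->
  dist u v = if u == v then 0 else if adj u v then 1 else 2.
Proof.
move=> d2; have := dist_le_diameter u v; have := diameter_le_card G.
(* As [#|G|] is at least the diameter 2, the search list starts with 0, 1. If both lengths fail, the
   upper bound 2 leaves only the value 2. *)
rewrite d2 /dist; case: #|G| => [|[|n]] //= _.
rewrite walk_of_length0 walk_of_length1.
by case: eqP => // _; case: adj => //; case: find.
Qed.

Lemma eq_card_closer (G : sgraph) (u v : G) : diameter G = 2 -> u != v ->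
  (#|closer u v| == #|closer v u|) = (degree u == degree v).
Proof.
move=> d2.
(* The terms added to [#|closer x y|] are symmetric in [x] and [y], so they cancel when the two
   instances are compared. *)
have half (x y : G) : x != y ->
    #|closer x y| + (#|[set w | adj x w & adj y w]| + adj x y) = (degree x).+1.
  move=> xy; pose N z := [set w : G | adj z w].
  have -> : closer x y = x |: (N x :\: (y |: N y)).
    apply/setP => w; rewrite !inE !distE // (eq_sym w y) (eq_sym w x).
    case: (eqVneq x w) => [<-|_]; first by rewrite eq_sym (negPf xy); case: adj.
    by case: (eqVneq y w) => _; case: (adj x w) => //; case: (adj y w).
  rewrite cardsU1 !inE adj_irrefl andbF add1n addSn /degree -/(N x).
  rewrite -(cardsID (y |: N y) (N x)) addnC; congr (_ + _).+1.
  (* Within [N x], the closed neighbourhood of [y] leaves the common neighbours, plus [y] itself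
     exactly when [x] and [y] are adjacent. *)
  have [axy|naxy] := boolP (adj x y).
    rewrite [RHS](cardsD1 y) !inE axy eqxx addnC; congr (_ + #|pred_of_set _|).
    apply/setP => w; rewrite !inE; case: (eqVneq w y) => [->|] //=.
    by rewrite adj_irrefl andbF.
  rewrite addn0; congr #|pred_of_set _|; apply/setP => w; rewrite !inE.
  by case: (eqVneq w y) => [->|] //=; rewrite (negPf naxy).
move=> uv; have vu : v != u by rewrite eq_sym.
rewrite -[RHS]eqSS -(half u v uv) -(half v u vu) (adj_sym v u).
rewrite (_ : [set w | adj v w & adj u w] = [set w | adj u w & adj v w]).
  by rewrite eqn_add2r.
by apply/setP => w; rewrite !inE andbC.
Qed.

Lemma distance_balanced1P (G : sgraph) :
  graph_connected G -> diameter G = 2 -> distance_balanced 1 G <-> regular G.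
Proof.
move=> Gc d2; split=> [[_ _ _ bal]|[k reg]]; last first.
  split; rewrite ?d2 // => u v; rewrite distE //; case: eqVneq => // uv _.
  by apply/eqP; rewrite eq_card_closer // !reg.
case: Gc => /card_gt0P[u _] conn; exists (degree u) => v.
(* The degree class of [u] is closed under adjacency, so by connectedness it contains every
   vertex. *)
have cl : closed (@adj G) [pred w | degree w == degree u].
  move=> x y xy; rewrite !inE; congr (_ == _); apply/eqP.
  have xNy : x != y by apply: contraTneq xy => ->; rewrite adj_irrefl.
  by rewrite -eq_card_closer //; apply/eqP/bal; rewrite distE // (negPf xNy) xy.
have := closed_connect cl (conn u v); rewrite !inE eqxx => /esym.
exact/eqP.
Qed.

Lemma distance_balanced2P (G : sgraph) :
  graph_connected G -> diameter G = 2 ->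
  distance_balanced 2 G <-> nonadj_eq_degree G.
Proof.
move=> Gc d2; split=> [[_ _ _ bal] u v nuv|eqd].
  case: (eqVneq u v) => [-> //|uv]; apply/eqP.
  rewrite -eq_card_closer //; apply/eqP/bal.
  by rewrite distE // (negPf uv) (negPf nuv).
split; rewrite ?d2 // => u v; rewrite distE //; case: eqVneq => // uv.
case: ifPn => // nuv _; apply/eqP.
by rewrite eq_card_closer //; apply/eqP/eqd.
Qed.

(** * Joins *)

Lemma degree_joinl (G H : sgraph) (u : G) :
  degree (inl u : join G H) = degree u + #|H|.
Proof.
rewrite /degree !cardsE -!sum1_card big_sumType /=.
by congr (_ + _); apply: eq_bigl.
Qed.

Lemma degree_joinr (G H : sgraph) (u : H) :
  degree (inr u : join G H) = #|G| + degree u.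
Proof.
rewrite /degree !cardsE -!sum1_card big_sumType /=.
by congr (_ + _); apply: eq_bigl.
Qed.

Lemma nonadj_eq_degree_regular (G : sgraph) : regular G -> nonadj_eq_degree G.
Proof. by move=> [k reg] u v _; rewrite !reg. Qed.

(** Nonadjacent vertices of a join lie in the same summand, and the join raises both degrees by the
    order of the other summand. *)
Lemma nonadj_eq_degree_join (G H : sgraph) :
  nonadj_eq_degree G -> nonadj_eq_degree H -> nonadj_eq_degree (join G H).
Proof.
move=> hG hH [u|u] [v|v] //= nuv.
  by rewrite !degree_joinl (hG _ _ nuv).
by rewrite !degree_joinr (hH _ _ nuv).
Qed.

Lemma nonadj_eq_degree_iter_join (F : nat -> sgraph) (n : nat) :
  (forall i, i <= n -> regular (F i)) -> nonadj_eq_degree (iter_join F n).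
Proof.
elim: n => [|n IHn] reg; first exact/nonadj_eq_degree_regular/reg.
apply: nonadj_eq_degree_join; first by apply: IHn => i /leqW; apply: reg.
exact/nonadj_eq_degree_regular/reg.
Qed.

Lemma degree_iso (G H : sgraph) (f : G -> H) (u : G) :
  bijective f -> (forall u v, adj (f u) (f v) = adj u v) ->
  degree (f u) = degree u.
Proof.
move=> bij_f adj_f; rewrite /degree -(card_imset _ (bij_inj bij_f)).
congr #|pred_of_set _|; apply/setP => w.
case: bij_f => g fK gK; rewrite -(gK w) (mem_imset _ _ (can_inj fK)) !inE.
by rewrite adj_f.
Qed.

Lemma nonadj_eq_degree_iso (G H : sgraph) :
  graph_iso G H -> nonadj_eq_degree H -> nonadj_eq_degree G.
Proof.
move=> [f [bij_f adj_f]] hH u v nuv.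
rewrite -(degree_iso u bij_f adj_f) -(degree_iso v bij_f adj_f).
by apply: hH; rewrite adj_f.
Qed.

(** * Decomposition into induced subgraphs *)

Definition induced_adj (G : sgraph) (P : pred G) : rel {x : G | P x} :=
  fun x y => adj (val x) (val y).

Lemma induced_adj_sym (G : sgraph) (P : pred G) : symmetric (@induced_adj G P).
Proof. by move=> x y; apply: adj_sym. Qed.

Lemma induced_adj_irrefl (G : sgraph) (P : pred G) :
  irreflexive (@induced_adj G P).
Proof. by move=> x; apply: adj_irrefl. Qed.

Definition induced (G : sgraph) (P : pred G) : sgraph :=
  SGraph (@induced_adj_sym G P) (@induced_adj_irrefl G P).

Lemma degree_induced (G : sgraph) (P : pred G) (u : induced P) :
  degree u = #|[set w | adj (val u) w & P w]|.
Proof.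
rewrite /degree -(card_imset _ val_inj); congr #|pred_of_set _|.
apply/setP => w; rewrite inE; apply/imsetP/andP => [[x]|[uw Pw]].
  by rewrite inE => ux ->; split; [exact: ux | exact: valP x].
by exists (exist _ w Pw); rewrite // inE.
Qed.

(** Passing to the induced subgraph, each vertex of [P] loses the same number of neighbours, namely
    all the vertices outside [P]. *)
Lemma regular_induced (G : sgraph) (P : pred G) (k : nat) :
  (forall u, P u -> degree u = k) ->
  (forall u v, P u -> ~~ P v -> adj u v) -> regular (induced P).
Proof.
move=> degP adjP; exists (k - #|[set w | ~~ P w]|) => u.
rewrite degree_induced -(degP _ (valP u)) /degree.
rewrite -(cardsID [set w | P w] [set w | adj (val u) w]).
rewrite (_ : _ :\: _ = [set w | ~~ P w]); last first.
  apply/setP => w; rewrite !inE andbC.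
  by case: (boolP (P w)) => Pw; rewrite ?andbF // adjP // (valP u).
rewrite addnK; congr #|pred_of_set _|; apply/setP => w; by rewrite !inE.
Qed.

(** Induction on [n], adding one colour class at a time. An embedding with a prescribed image,
    rather than an isomorphism, lets the step extend [f] inside the fixed graph [G]. *)
Lemma iter_join_colouring (G : sgraph) (c : G -> nat) (n : nat) :
  (forall u v, c u != c v -> adj u v) ->
  exists f : iter_join (fun i => induced (fun u => c u == i)) n -> G,
    [/\ injective f, forall x y, adj (f x) (f y) = adj x y,
        forall x, c (f x) <= n & forall v, c v <= n -> exists x, f x = v].
Proof.
move=> adjc; elim: n => [|n [f [inj_f adj_f cf surj_f]]].
  exists val; split=> //= [|x|v]; first exact: val_inj.
    by rewrite (eqP (valP x)).
  by rewrite leqn0 => cv; exists (exist _ v cv).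
(* Old and new vertices differ in colour, which gives both injectivity and adjacency across the two
   parts. *)
have lr x (y : induced (fun u => c u == n.+1)) : c (f x) != c (val y).
  by rewrite (eqP (valP y)) neq_ltn ltnS cf.
exists (fun x => match x with inl y => f y | inr y => val y end); split.
- move=> [x|x] [y|y] /= e.
  + by rewrite (inj_f _ _ e).
  + by have := lr x y; rewrite e eqxx.
  + by have := lr y x; rewrite -e eqxx.
  + by rewrite (val_inj e).
- move=> [x|x] [y|y] //=; first exact/adjc/lr.
  by rewrite adj_sym; apply/adjc/lr.
- by move=> [x|x]; rewrite ?(eqP (valP x)) // leqW.
- move=> v; rewrite leq_eqVlt => /predU1P[/eqP cv|/surj_f[x <-]].
    by exists (inr (exist _ v cv)).
  by exists (inl x).
Qed.

Lemma join_of_degree_classes (G : sgraph) :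
  0 < #|G| -> nonadj_eq_degree G -> ~ regular G -> join_of_regular_graphs G.
Proof.
move=> /card_gt0P[u0 _] eqd nreg.
(* Indexing the distinct degrees numbers the classes consecutively from 0, as [iter_join] requires,
   with no class empty. *)
pose s := undup [seq degree v | v : G].
have in_s (v : G) : degree v \in s.
  by rewrite mem_undup; apply/mapP; exists v; rewrite ?mem_enum.
pose c (v : G) := index (degree v) s.
have c_lt v : c v < size s by rewrite index_mem.
have degc v : degree v = nth 0 s (c v) by rewrite nth_index.
have adjc u v : c u != c v -> adj u v.
  by apply: contraNT => /eqd; rewrite /c => ->.
exists (size s), (fun i => induced (fun u => c u == i)).
have s_gt1 : 1 < size s.
  rewrite ltnNge; apply/negP => s_le1; case: nreg; exists (nth 0 s 0) => v.
  by rewrite degc; congr nth; have := leq_trans (c_lt v) s_le1; case: (c v).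
split=> // [i lt_i|].
  split.
    have : nth 0 s i \in s by rewrite mem_nth.
    rewrite mem_undup => /mapP[v _ ev].
    have cv : c v == i by rewrite /c -ev index_uniq ?undup_uniq.
    by apply/card_gt0P; exists (exist _ v cv).
  apply: (@regular_induced _ _ (nth 0 s i)) => [u /eqP <- //|u v /eqP <- nv].
  by apply: adjc; rewrite eq_sym.
have [f [inj_f adj_f _ surj_f]] := iter_join_colouring (size s).-1 adjc.
have {}surj_f v : exists x, f x == v.
  have [|x <-] := surj_f v; last by exists x.
  by rewrite -ltnS prednK // (ltn_trans _ s_gt1).
(* The isomorphism must start from [G], so [f] is inverted by choosing preimages. *)
pose g v := xchoose (surj_f v).
have gK : cancel g f by move=> v; apply/eqP/(xchooseP (surj_f v)).
exists g; split=> [|u v]; last by rewrite -adj_f !gK.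
by exists f => // x; apply: inj_f; rewrite gK.
Qed.

Theorem theorem3p2 (G : sgraph) (hconn : graph_connected G)
    (hdiam : diameter G = 2) :
  (highly_distance_balanced G <-> regular G) /\
  ((distance_balanced 2 G /\ ~ distance_balanced 1 G) <->
   (~ regular G /\ join_of_regular_graphs G)).
Proof.
have [db1_reg reg_db1] := distance_balanced1P hconn hdiam.
have [db2_eqd eqd_db2] := distance_balanced2P hconn hdiam.
split; split.
- by case=> _ bal; apply/db1_reg/bal; rewrite hdiam.
- move=> reg; split=> // -[|[|[|l]]]; rewrite hdiam // => _.
    exact: reg_db1.
  exact/eqd_db2/nonadj_eq_degree_regular.
- move=> [/db2_eqd eqd ndb1].
  have nreg : ~ regular G by move/reg_db1.
  by split=> //; apply: join_of_degree_classes => //; case: hconn.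
- move=> [nreg [t [F [t_gt1 regF iso]]]]; split; last by move/db1_reg.
  apply: eqd_db2; apply: nonadj_eq_degree_iso iso _.
  apply: nonadj_eq_degree_iter_join => i le_i.
  (* Since [t] is positive, [i <= t.-1] amounts to [i < t]. *)
  by have [] := regF i _; last by []; case: t t_gt1 le_i {regF}.
Qed.
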